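(* Let $(M,g)$ be a Riemannian $n$-manifold with curvature tensor $R_M$, and let $h$ be a scalar field on $M$ with $g^{ab}h_{;a}h_{;b}<1$ satisfying $$(R_M)_{pijk}=\frac{h_{;pj}h_{;ik}-h_{;pk}h_{;ij}}{1-g^{ab}h_{;a}h_{;b}}.$$ Let $N\subset M$ be an $(n-1)$-dimensional submanifold on which $h$ is constant and along which $h_{;a}\neq 0$, endowed with the induced metric, and let $R_N$ be its curvature tensor. Then $$(R_N)_{ijkl}=\frac{1}{g^{mn}h_{;m}h_{;n}}\,(R_M)_{ijkl},$$ where $(R_M)_{ijkl}=(R_M)_{abcd}P^a_iP^b_jP^c_kP^d_l$ is the restriction (pullback) of $R_M$ to $TN$, $P^a_i$ being the differential of the inclusion of $N$ in $M$.
   Context: All objects are smooth. '';'' is covariant differentiation with respect to the Levi-Civita connection of $g$; repeated upper/lower indices are summed. Curvature sign convention: the unit round sphere has $R_{pijk}=g_{pj}g_{ik}-g_{pk}g_{ij}$ (the same convention is used for $R_N$ with the induced metric). The submanifolds $N$ are the cross-sections, by hyperplanes, of the immersion of $M$ in $\mathbb{R}^{n+1}$ having $h$ as a height function. *)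

(* Defs.v *)
From HB Require Import structures.
From mathcomp Require Import all_boot all_order all_algebra.
From mathcomp Require Import boolp classical_sets functions cardinality reals.
From mathcomp Require Import topology normedtype derive.

Set Implicit Arguments.
Unset Strict Implicit.
Unset Printing Implicit Defensive.

Import Order.TTheory GRing.Theory Num.Theory.
Import numFieldNormedType.Exports.

Local Open Scope classical_set_scope.
Local Open Scope ring_scope.

Definition partial (R : realType) (n : nat) (i : 'I_n) (f : 'rV[R]_n -> R)
    (x : 'rV[R]_n) : R :=
  'D_(delta_mx ord0 i) f x.

(* C^oo on U (used with U open): f and all its iterated partial derivatives
   are differentiable at every point of U. *)
Definition smooth_on (R : realType) (n : nat) (U : set 'rV[R]_n)
    (f : 'rV[R]_n -> R) : Prop :=
  forall (s : seq 'I_n) (x : 'rV[R]_n),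
    U x -> differentiable (foldr (@partial R n) f s) x.

Definition smooth_map_on (R : realType) (m n : nat) (U : set 'rV[R]_m)
    (F : 'rV[R]_m -> 'rV[R]_n) : Prop :=
  forall a : 'I_n, smooth_on U (fun x => F x ord0 a).

(* A homeomorphism of an open set of M onto an open set of R^n. Both maps are
   total, but only chart_map on chart_dom and chart_inv on
   chart_map @` chart_dom are meaningful. *)
Record chart (R : realType) (M : topologicalType) (n : nat) := Chart {
  chart_dom : set M;
  chart_map :> M -> 'rV[R]_n;
  chart_inv : 'rV[R]_n -> M;
  chart_dom_open : open chart_dom;
  chart_img_open : open (chart_map @` chart_dom);
  chart_mapK : {in chart_dom, cancel chart_map chart_inv};
  chart_map_continuous : {in chart_dom, continuous chart_map};
  chart_inv_continuous : {in chart_map @` chart_dom, continuous chart_inv}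
}.

(* Smooth n-manifolds without boundary. The atlas need not be maximal. *)
Record manifold (R : realType) (n : nat) := Manifold {
  carrier :> topologicalType;
  manifold_hausdorff : hausdorff_space carrier;
  manifold_second_countable : @second_countable carrier;
  atlas : set (chart R carrier n);
  atlas_cover : forall p : carrier, exists2 c, atlas c & chart_dom c p;
  atlas_smooth : forall c d, atlas c -> atlas d ->
    smooth_map_on (c @` (chart_dom c `&` chart_dom d)) (d \o chart_inv c)
}.

(* c is an admissible chart around p *)
Definition chart_at (R : realType) (n : nat) (M : manifold R n)
    (c : chart R M n) (p : M) : Prop :=
  atlas c /\ chart_dom c p.

Definition smooth_map (R : realType) (m n : nat) (N : manifold R m)
    (M : manifold R n) (f : N -> M) : Prop :=
  continuous f /\
  forall (c : chart R N m) (d : chart R M n), atlas c -> atlas d ->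
    smooth_map_on (c @` (chart_dom c `&` f @^-1` chart_dom d))
                  (d \o f \o chart_inv c).

Definition smooth_field (R : realType) (n : nat) (M : manifold R n)
    (h : M -> R) : Prop :=
  forall c : chart R M n, atlas c ->
    smooth_on (c @` chart_dom c) (h \o chart_inv c).

(* The components P^a_i = d(f^a)/dx^i at p of the differential of f in the
   charts c and d; row i, column a. *)
Definition differential (R : realType) (m n : nat) (N : manifold R m)
    (M : manifold R n) (f : N -> M) (c : chart R N m) (d : chart R M n)
    (p : N) : 'M[R]_(m, n) :=
  \matrix_(i < m, a < n)
    partial i (fun x => (d \o f \o chart_inv c) x ord0 a) (c p).

Definition immersion (R : realType) (m n : nat) (N : manifold R m)
    (M : manifold R n) (f : N -> M) : Prop :=
  smooth_map f /\
  forall (p : N) (c : chart R N m) (d : chart R M n),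
    chart_at c p -> chart_at d (f p) -> row_free (differential f c d p).

(* A covariant 2-tensor field is given classically, by its components in every
   chart, as functions of the coordinates. The transformation law under changes
   of charts is the case f = id of is_pullback below. *)
Definition components2 (R : realType) (n : nat) (M : manifold R n) :=
  chart R M n -> 'rV[R]_n -> 'M[R]_n.

(* gN = f^* gM *)
Definition is_pullback (R : realType) (m n : nat) (N : manifold R m)
    (M : manifold R n) (f : N -> M) (gN : components2 N) (gM : components2 M) :
    Prop :=
  forall (p : N) (c : chart R N m) (d : chart R M n),
    chart_at c p -> chart_at d (f p) ->
    let P := differential f c d p in
    forall i j : 'I_m,
      gN c (c p) i j =
      \sum_(a < n) \sum_(b < n) gM d (d (f p)) a b * P i a * P j b.

Record metric (R : realType) (n : nat) (M : manifold R n) := Metric {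
  metric_mx :> components2 M;
  metric_smooth : forall c : chart R M n, atlas c -> forall i j : 'I_n,
    smooth_on (c @` chart_dom c) (fun x => metric_mx c x i j);
  metric_sym : forall (c : chart R M n) (p : M), chart_at c p ->
    forall i j : 'I_n, metric_mx c (c p) i j = metric_mx c (c p) j i;
  metric_pos : forall (c : chart R M n) (p : M), chart_at c p ->
    forall v : 'rV[R]_n, v != 0 ->
      0 < \sum_(i < n) \sum_(j < n)
            metric_mx c (c p) i j * v ord0 i * v ord0 j;
  metric_transition : is_pullback (@id M) metric_mx metric_mx
}.

(* Formulas in one coordinate system: g is the matrix of the metric, as a
   function of the coordinates. *)

(* g^{ab} *)
Definition ginv (R : realType) (n : nat) (g : 'rV[R]_n -> 'M[R]_n)
    (x : 'rV[R]_n) (a b : 'I_n) : R :=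
  invmx (g x) a b.

(* christoffel g c a b is Gamma^c_{ab} *)
Definition christoffel (R : realType) (n : nat) (g : 'rV[R]_n -> 'M[R]_n)
    (c a b : 'I_n) (x : 'rV[R]_n) : R :=
  2^-1 * \sum_(d < n) ginv g x c d *
    (partial a (fun y => g y b d) x + partial b (fun y => g y a d) x
     - partial d (fun y => g y a b) x).

(* w_{a;b} for a covector field w *)
Definition covariant_derivative (R : realType) (n : nat)
    (g : 'rV[R]_n -> 'M[R]_n) (w : 'I_n -> 'rV[R]_n -> R) (a b : 'I_n)
    (x : 'rV[R]_n) : R :=
  partial b (w a) x - \sum_(c < n) christoffel g c a b x * w c x.

(* R^a_{ijk} = d_j Gamma^a_{ik} - d_k Gamma^a_{ij}
               + Gamma^a_{jb} Gamma^b_{ik} - Gamma^a_{kb} Gamma^b_{ij} *)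
Definition riemann_up (R : realType) (n : nat) (g : 'rV[R]_n -> 'M[R]_n)
    (a i j k : 'I_n) (x : 'rV[R]_n) : R :=
  partial j (christoffel g a i k) x - partial k (christoffel g a i j) x
  + \sum_(b < n) (christoffel g a j b x * christoffel g b i k x
                  - christoffel g a k b x * christoffel g b i j x).

(* R_{pijk} = g_{pa} R^a_{ijk}; with this sign the unit round sphere has
   R_{pijk} = g_{pj} g_{ik} - g_{pk} g_{ij}. *)
Definition riemann (R : realType) (n : nat) (g : 'rV[R]_n -> 'M[R]_n)
    (p i j k : 'I_n) (x : 'rV[R]_n) : R :=
  \sum_(a < n) g x p a * riemann_up g a i j k x.

Definition curvature (R : realType) (n : nat) (M : manifold R n) (g : metric M)
    (c : chart R M n) (p : M) (i j k l : 'I_n) : R :=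
  riemann (metric_mx g c) i j k l (c p).

(* h_{;a} *)
Definition dfield (R : realType) (n : nat) (M : manifold R n) (h : M -> R)
    (c : chart R M n) (p : M) (a : 'I_n) : R :=
  partial a (h \o chart_inv c) (c p).

(* h_{;ab} *)
Definition hessian (R : realType) (n : nat) (M : manifold R n) (g : metric M)
    (h : M -> R) (c : chart R M n) (p : M) (a b : 'I_n) : R :=
  covariant_derivative (metric_mx g c) (fun a' => partial a' (h \o chart_inv c)) a b
    (c p).

(* g^{ab} h_{;a} h_{;b} *)
Definition grad_sq (R : realType) (n : nat) (M : manifold R n) (g : metric M)
    (h : M -> R) (c : chart R M n) (p : M) : R :=
  \sum_(a < n) \sum_(b < n)
    ginv (metric_mx g c) (c p) a b * dfield h c p a * dfield h c p b.

(* Main.v *)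
Require Import Defs.
From HB Require Import structures.
From mathcomp Require Import all_boot all_order all_algebra.
From mathcomp Require Import boolp classical_sets functions cardinality reals.
From mathcomp Require Import topology normedtype landau derive.
From mathcomp Require Import ring.

Set Implicit Arguments.
Unset Strict Implicit.
Unset Printing Implicit Defensive.

Import Order.TTheory GRing.Theory Num.Theory.
Import numFieldNormedType.Exports.

Local Open Scope classical_set_scope.
Local Open Scope ring_scope.

(** The identity is the Gauss equation of a level set, read off in one chart
    [c] of [N] and one chart [d] of [M]. Let [F = d \o iota \o c^-1], with
    coordinate velocities [F_i], let [<.,.>] be the metric [g] of [M] and [D_j]
    the Levi-Civita derivative along [F], and put [A_ij := D_j F_i].

    - Gauss: [A_ij] is symmetric and the Christoffel symbols of the first kind of
      the induced metric are [<F_k, A_ij>] ([christoffel1_pullback]).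
      Differentiating once more, the third derivatives of [F] enter only through
      [D_j A_ik - D_k A_ij], which is the curvature of [M] applied to [F_i]
      ([covderiv_map_hessianB]). What remains is the part of
      [<A_pj, A_ik> - <A_pk, A_ij>] normal to [N] ([gauss_equation]).
    - The normal space is the line spanned by [grad h], so the normal part of
      [<u, v>] is [dh(u) dh(v) / |grad h|^2] ([codim1_normal_dot]).
    - [h] is constant along [F]; differentiating [dh(F_i) = 0] gives
      [dh(A_ij) = - Hess h(F_i, F_j)] ([map_hessian_level_set]).

    With [K := Hess h(F_p, F_j) Hess h(F_i, F_k) - Hess h(F_p, F_k) Hess h(F_i, F_j)]
    and [c := |grad h|^2] this says [R_N = R_M + K / c] on [TN], while the
    hypothesis on [R_M] says [R_M = K / (1 - c)] there. Hence
    [R_N = R_M (1 + (1 - c) / c) = R_M / c]. *)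

(** * Symmetry of second derivatives *)

Lemma is_derive_along_line (R : realType) (V : normedModType R) (f : V -> R)
    (a u w : V) (s : R) : differentiable f (a + s *: u + w) ->
  is_derive s 1 (fun s => f (a + s *: u + w)) ('D_u f (a + s *: u + w)).
Proof.
move=> fd; pose L := fun s : R => a + s *: u + w.
have Ld : is_diff s L ( *:%R ^~ u).
  have -> : L = cst a + *:%R ^~ u + cst w by [].
  by apply: is_diff_eq; rewrite add0r addr0.
have cd : is_diff s (f \o L) ('d f (L s) \o *:%R ^~ u).
  by apply: is_diff_comp; apply: differentiableP.
apply: DeriveDef; first exact/diff_derivable.
by rewrite !deriveE // [in LHS]diff_val /= scale1r.
Qed.

(** The mean value theorem in the direction [u] turns the second difference
    into [t] times an increment of ['D_u f], which is then expanded to first order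
    at [a]. *)
Lemma second_difference_le (R : realType) (V : normedModType R)
    (f : V -> R) (a u v : V) (e : R) : 0 < e ->
  (\forall y \near a, differentiable f y) ->
  differentiable ('D_u f) a ->
  \forall t \near (0 : R)^'+,
    `|f (a + t *: u + t *: v) - f (a + t *: u) - f (a + t *: v) + f a
      - t ^+ 2 * 'D_v ('D_u f) a| <= e * t ^+ 2.
Proof.
move=> e0 fdiff; set g := 'D_u f => gdiff.
(* The summand 1 keeps C positive when u and v vanish. *)
set C := `|u| + `|v| + 1.
have C0 : 0 < C by rewrite /C ltr_wpDl // addr_ge0.
have e'0 : 0 < e / (2 * C) by rewrite divr_gt0 // mulr_gt0.
have /nbhs_ballP [r /= r0 rP] : \forall w \near (0 : V), differentiable f (w + a) /\
    `|g (w + a) - g a - 'd g a w| <= (e / (2 * C)) * `|w|.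
  apply: filterI; first by move: fdiff; rewrite (near_shift 0) subr0.
  have /eqaddoP gexp := diff_locally gdiff.
  near=> w.
  have -> : g (w + a) - g a - 'd g a w = (g \o shift a - (cst (g a) + 'd g a)) w.
    by rewrite /= -addrA -opprD.
  by near: w; exact: gexp.
have rP' w : `|w| < r -> differentiable f (a + w) /\
    `|g (a + w) - g a - 'd g a w| <= (e / (2 * C)) * `|w|.
  by move=> wr; rewrite [a + w]addrC; apply: rP; rewrite -ball_normE /= sub0r normrN.
near=> t.
have t0 : 0 < t by near: t; exact: nbhs_right_gt.
have tr : t * C < r.
  rewrite -ltr_pdivlMr //; near: t; apply: nbhs_right_lt; exact: divr_gt0.
have nle c b : 0 <= c <= t -> 0 <= b <= t -> `|c *: u + b *: v| <= t * C.
  move=> /andP[c0 ct] /andP[b0 bt]; rewrite (le_trans (ler_normD _ _)) // !normrZ.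
  rewrite !ger0_norm // /C !mulrDr mulr1; apply: ler_wpDr; first exact: ltW.
  by apply: lerD; apply: ler_wpM2r.
pose phi s := f (a + s *: u + t *: v) - f (a + s *: u + 0).
pose dphi s := g (a + s *: u + t *: v) - g (a + s *: u + 0).
have tt : 0 <= t <= t by rewrite lexx ltW.
have t00 : 0 <= (0 : R) <= t by rewrite lexx ltW.
have ntr b s : 0 <= s <= t -> 0 <= b <= t -> `|s *: u + b *: v| < r.
  by move=> st bt; exact: le_lt_trans (nle _ _ st bt) tr.
have phi' s : 0 <= s <= t -> is_derive s 1 phi (dphi s).
  move=> st; apply: is_deriveB; apply: is_derive_along_line.
    by rewrite -addrA; exact: (rP' _ (ntr _ _ st tt)).1.
  by rewrite -(scale0r v) -addrA; exact: (rP' _ (ntr _ _ st t00)).1.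
have [||s st phiE] := @MVT R phi dphi 0 t t0.
- by move=> s; rewrite in_itv /= => /andP[??]; apply: phi'; rewrite !ltW.
- apply: derivable_within_continuous => s; rewrite in_itv /= => st.
  by have [] := phi' _ st.
have st' : 0 <= s <= t by move: st; rewrite in_itv /= => /andP[??]; rewrite !ltW.
have -> : f (a + t *: u + t *: v) - f (a + t *: u) - f (a + t *: v) + f a =
    phi t - phi 0.
  by rewrite /phi !scale0r !addr0; ring.
rewrite phiE subr0 /dphi deriveE //.
have [_ b1] := rP' _ (ntr _ _ st' tt).
have [_ b0] := rP' _ (ntr _ _ st' t00).
(* The two first-order expansions differ by exactly t * 'd g a v. *)
have dE : 'd g a (s *: u + t *: v) - 'd g a (s *: u + 0 *: v) = t * 'd g a v.
  by rewrite -linearB scale0r addr0 addrAC subrr add0r linearZ.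
have -> : (g (a + s *: u + t *: v) - g (a + s *: u + 0)) * t - t ^+ 2 * 'd g a v =
   t * ((g (a + (s *: u + t *: v)) - g a - 'd g a (s *: u + t *: v)) -
        (g (a + (s *: u + 0 *: v)) - g a - 'd g a (s *: u + 0 *: v))).
  by rewrite expr2 -mulrA -dE !addrA scale0r; ring.
rewrite normrM (gtr0_norm t0) expr2 mulrA [e * t]mulrC -mulrA.
apply: ler_wpM2l; first exact: ltW.
apply: le_trans (ler_normB _ _) _.
have -> : e * t = e / (2 * C) * (t * C) + e / (2 * C) * (t * C).
  by field; rewrite gt_eqF.
by apply: lerD; [apply: le_trans b1 _|apply: le_trans b0 _];
  (apply: ler_wpM2l; [exact: ltW|exact: nle]).
Unshelve. all: by end_near.
Qed.

(** The second difference is symmetric in [u] and [v], and divided by [t ^+ 2]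
    it approximates both iterated derivatives. *)
Lemma deriveC (R : realType) (V : normedModType R) (f : V -> R) (a u v : V) :
  (\forall y \near a, differentiable f y) ->
  differentiable ('D_u f) a -> differentiable ('D_v f) a ->
  'D_v ('D_u f) a = 'D_u ('D_v f) a.
Proof.
move=> fd ud vd; apply/eqP; rewrite -subr_eq0 -normr_le0.
apply/ler_addgt0Pl => e e0; rewrite addr0.
have e2 : 0 < e / 2 by rewrite divr_gt0.
have Huv := second_difference_le v e2 fd ud.
have Hvu := second_difference_le u e2 fd vd.
have [t [[t0 duv] dvu]] := filter_ex (filterI (filterI (nbhs_right_gt 0) Huv) Hvu).
rewrite -(@ler_pM2l _ (t ^+ 2)) ?exprn_gt0 //.
rewrite -[X in X * `|_|]gtr0_norm ?exprn_gt0 // -normrM.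
have -> : t ^+ 2 * e = e / 2 * t ^+ 2 + e / 2 * t ^+ 2 by field.
have swap : a + t *: v + t *: u = a + t *: u + t *: v by rewrite addrAC.
apply: le_trans (lerD dvu duv); apply: le_trans (ler_normB _ _).
rewrite swap le_eqVlt; apply/orP; left; apply/eqP; congr `|_|.
move: (f _) (f _) (f _) (f _) ('D_v _ _) ('D_u _ _) => A B C D E F.
by ring.
Qed.

(** * Calculus of partial derivatives *)

Lemma differentiable_bigsum (R : realType) (V : normedModType R) (I : Type)
    (r : seq I) (f : I -> V -> R) (x : V) :
  (forall i, differentiable (f i) x) ->
  differentiable (fun y => \sum_(i <- r) f i y) x.
Proof.
move=> fd; elim: r => [|i r IH].
  under [fun y => _]funext do rewrite big_nil; exact: differentiable_cst.
by under [fun y => _]funext do rewrite big_cons; exact: differentiableD.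
Qed.

Lemma differentiable_bigprod (R : realType) (V : normedModType R) (I : Type)
    (r : seq I) (f : I -> V -> R) (x : V) :
  (forall i, differentiable (f i) x) ->
  differentiable (fun y => \prod_(i <- r) f i y) x.
Proof.
move=> fd; elim: r => [|i r IH].
  under [fun y => _]funext do rewrite big_nil; exact: differentiable_cst.
by under [fun y => _]funext do rewrite big_cons; exact: differentiableM.
Qed.

(** A function that agrees with [f] near [x] has the first-order expansion
    of [f] there. *)
Lemma differentiable_near_eq (R : realType) (V W : normedModType R)
    (f g : V -> W) (x : V) :
  (\near x, f x = g x) -> differentiable f x -> differentiable g x.
Proof.
move=> fg /diff_locallyP[fc /eqaddoP fe].
have ge : g \o shift x = cst (g x) + 'd f x +o_ 0 id.
  apply/eqaddoP => e e0; have := fe e e0.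
  move: (fg); rewrite (near_shift 0) subr0 => fg0.
  apply: filterS2 fg0 => y /= fgy.
  rewrite /= !fctE /= fgy.
  by rewrite (nbhs_singleton fg).
apply/diff_locallyP; suff -> : 'd g x = 'd f x :> (V -> W) by [].
exact: diff_unique.
Qed.

Lemma differentiable_det (R : realType) (V : normedModType R) (n : nat)
    (A : V -> 'M[R]_n) (x : V) :
  (forall i j, differentiable (fun y => A y i j) x) ->
  differentiable (fun y => \det (A y)) x.
Proof.
move=> Ad; apply: differentiable_bigsum => s; apply: differentiableM.
  exact: differentiable_cst.
by apply: differentiable_bigprod.
Qed.

(** Cramer's formula makes the entries of the inverse rational in those of
    [A]. *)
Lemma differentiable_invmx (R : realType) (V : normedModType R) (n : nat)
    (A : V -> 'M[R]_n) (x : V) :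
  (\near x, A x \in unitmx) ->
  (forall i j, differentiable (fun y => A y i j) x) ->
  forall i j, differentiable (fun y => invmx (A y) i j) x.
Proof.
move=> Au Ad i j.
apply: (@differentiable_near_eq _ _ _ (fun y => (\det (A y))^-1 * cofactor (A y) j i)).
  by near=> y; rewrite /invmx ifT ?mxE ?mxE //; near: y.
apply: differentiableM.
  apply: differentiableV; last by have := nbhs_singleton Au; rewrite unitmxE unitfE.
  exact: differentiable_det.
apply: differentiableM; first exact: differentiable_cst.
by apply: differentiable_det => k l; under [fun y => _]funext do rewrite !mxE.
Unshelve. all: by end_near.
Qed.

Lemma partial_near_eq (R : realType) (n : nat) (i : 'I_n) (f g : 'rV[R]_n -> R)
    (x : 'rV[R]_n) :
  (\near x, f x = g x) -> partial i f x = partial i g x.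
Proof. exact: near_eq_derive. Qed.

Lemma partial_cst (R : realType) (n : nat) (i : 'I_n) (c : R) (x : 'rV[R]_n) :
  partial i (fun=> c) x = 0.
Proof. exact: derive_cst. Qed.

Lemma partialD (R : realType) (n : nat) (i : 'I_n) (f g : 'rV[R]_n -> R)
    (x : 'rV[R]_n) : differentiable f x -> differentiable g x ->
  partial i (fun y => f y + g y) x = partial i f x + partial i g x.
Proof. by move=> fd gd; apply: deriveD; apply: diff_derivable. Qed.

Lemma partialM (R : realType) (n : nat) (i : 'I_n) (f g : 'rV[R]_n -> R)
    (x : 'rV[R]_n) : differentiable f x -> differentiable g x ->
  partial i (fun y => f y * g y) x = partial i f x * g x + f x * partial i g x.
Proof.
move=> fd gd; rewrite addrC [partial i f x * _]mulrC.
by apply: deriveM; apply: diff_derivable.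
Qed.

Lemma partial_sum (R : realType) (n k : nat) (i : 'I_n)
    (f : 'I_k -> 'rV[R]_n -> R) (x : 'rV[R]_n) :
  (forall j, differentiable (f j) x) ->
  partial i (fun y => \sum_(j < k) f j y) x = \sum_(j < k) partial i (f j) x.
Proof.
move=> fd; rewrite /partial -derive_sum; last by move=> j; apply: diff_derivable.
by congr ('D_ _ _ _); apply/funext => y; rewrite fct_sumE.
Qed.

Lemma differentiable_rV (R : realType) (V : normedModType R) (n : nat)
    (F : V -> 'rV[R]_n) (x : V) :
  (forall a, differentiable (fun y => F y ord0 a) x) -> differentiable F x.
Proof.
move=> Fd.
have -> : F = \sum_(a < n) (fun y => F y ord0 a *: delta_mx ord0 a).
  by apply/funext => y; rewrite fct_sumE; exact: row_sum_delta.
by apply: differentiable_sum => a; exact: differentiableZl.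
Qed.

Lemma differentiable_comp_rV (R : realType) (V : normedModType R) (n : nat)
    (F : V -> 'rV[R]_n) (f : 'rV[R]_n -> R) (x : V) :
  (forall a, differentiable (fun y => F y ord0 a) x) ->
  differentiable f (F x) -> differentiable (fun y => f (F y)) x.
Proof.
by move=> Fd fd; apply: differentiable_comp => //; exact: differentiable_rV.
Qed.

Lemma partial_comp (R : realType) (m n : nat) (i : 'I_m)
    (F : 'rV[R]_m -> 'rV[R]_n) (f : 'rV[R]_n -> R) (x : 'rV[R]_m) :
  (forall a, differentiable (fun y => F y ord0 a) x) ->
  differentiable f (F x) ->
  partial i (fun y => f (F y)) x =
  \sum_(a < n) partial a f (F x) * partial i (fun y => F y ord0 a) x.
Proof.
move=> Fd fd; have Fdx := differentiable_rV Fd.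
rewrite /partial deriveE; last exact: differentiable_comp.
rewrite [in LHS](diff_comp Fdx fd) /= -(deriveE _ Fdx) derive_mx; last first.
  exact: diff_derivable.
set w := \matrix_(_, _) _; rewrite (row_sum_delta w) linear_sum /=.
by apply: eq_bigr => a _; rewrite linearZ /= deriveE // mulrC mxE.
Qed.

Lemma smooth_on_differentiable (R : realType) (n : nat) (U : set 'rV[R]_n)
  (f : 'rV[R]_n -> R) (x : 'rV[R]_n) :
  smooth_on U f -> U x -> differentiable f x.
Proof. by move=> /(_ [::]); exact. Qed.

Lemma smooth_on_partial (R : realType) (n : nat) (U : set 'rV[R]_n)
  (f : 'rV[R]_n -> R) (i : 'I_n) :
  smooth_on U f -> smooth_on U (partial i f).
Proof. by move=> fs s x Ux; have := fs (rcons s i) x Ux; rewrite foldr_rcons. Qed.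

Lemma smooth_on_partialC (R : realType) (n : nat) (U : set 'rV[R]_n)
  (f : 'rV[R]_n -> R) (i j : 'I_n) (x : 'rV[R]_n) :
  open U -> smooth_on U f -> U x ->
  partial i (partial j f) x = partial j (partial i f) x.
Proof.
move=> Uo fs Ux; apply: deriveC.
- near=> y; apply: (smooth_on_differentiable fs).
  by near: y; exact: open_nbhs_nbhs.
- exact: (smooth_on_differentiable (smooth_on_partial j fs)).
- exact: (smooth_on_differentiable (smooth_on_partial i fs)).
Unshelve. all: by end_near.
Qed.

(** * Matrix-valued functions, metrics and Christoffel symbols *)

Definition mxpartial (R : realType) (m p q : nat) (l : 'I_m)
    (A : 'rV[R]_m -> 'M[R]_(p, q)) (x : 'rV[R]_m) : 'M[R]_(p, q) :=
  \matrix_(i, j) partial l (fun y => A y i j) x.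

Lemma mxpartialE (R : realType) (m p q : nat) (l : 'I_m)
    (A : 'rV[R]_m -> 'M[R]_(p, q)) (x : 'rV[R]_m) i j :
  mxpartial l A x i j = partial l (fun y => A y i j) x.
Proof. by rewrite mxE. Qed.

Definition mxdifferentiable (R : realType) (m p q : nat)
    (A : 'rV[R]_m -> 'M[R]_(p, q)) (x : 'rV[R]_m) : Prop :=
  forall i j, differentiable (fun y => A y i j) x.

Lemma mxdifferentiableD (R : realType) (m p q : nat)
    (A B : 'rV[R]_m -> 'M[R]_(p, q)) (x : 'rV[R]_m) :
  mxdifferentiable A x -> mxdifferentiable B x ->
  mxdifferentiable (fun y => A y + B y) x.
Proof.
move=> Ad Bd i j; under [fun y => _]funext do rewrite mxE.
exact: differentiableD.
Qed.

Lemma mxdifferentiableM (R : realType) (m p q r : nat)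
    (A : 'rV[R]_m -> 'M[R]_(p, q)) (B : 'rV[R]_m -> 'M[R]_(q, r))
    (x : 'rV[R]_m) :
  mxdifferentiable A x -> mxdifferentiable B x ->
  mxdifferentiable (fun y => A y *m B y) x.
Proof.
move=> Ad Bd i j; under [fun y => _]funext do rewrite mxE.
by apply: differentiable_bigsum => k; exact: differentiableM.
Qed.

Lemma mxdifferentiable_tr (R : realType) (m p q : nat)
    (A : 'rV[R]_m -> 'M[R]_(p, q)) (x : 'rV[R]_m) :
  mxdifferentiable A x -> mxdifferentiable (fun y => (A y)^T) x.
Proof. by move=> Ad i j; under [fun y => _]funext do rewrite mxE. Qed.

Lemma mxpartial_near_eq (R : realType) (m p q : nat) (l : 'I_m)
    (A B : 'rV[R]_m -> 'M[R]_(p, q)) (x : 'rV[R]_m) :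
  (\near x, A x = B x) -> mxpartial l A x = mxpartial l B x.
Proof.
move=> AB; apply/matrixP => i j; rewrite !mxE; apply: partial_near_eq.
by apply: filterS AB => y ->.
Qed.

Lemma mxpartialD (R : realType) (m p q : nat) (l : 'I_m)
    (A B : 'rV[R]_m -> 'M[R]_(p, q)) (x : 'rV[R]_m) :
  mxdifferentiable A x -> mxdifferentiable B x ->
  mxpartial l (fun y => A y + B y) x = mxpartial l A x + mxpartial l B x.
Proof.
move=> Ad Bd; apply/matrixP => i j; rewrite !mxE -partialD //.
by under [fun y => _]funext do rewrite mxE.
Qed.

Lemma mxpartialM (R : realType) (m p q r : nat) (l : 'I_m)
    (A : 'rV[R]_m -> 'M[R]_(p, q)) (B : 'rV[R]_m -> 'M[R]_(q, r))
    (x : 'rV[R]_m) :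
  mxdifferentiable A x -> mxdifferentiable B x ->
  mxpartial l (fun y => A y *m B y) x =
  mxpartial l A x *m B x + A x *m mxpartial l B x.
Proof.
move=> Ad Bd; apply/matrixP => i j; rewrite !mxE -big_split /=.
under [fun y => _]funext do rewrite mxE.
rewrite partial_sum; last by move=> k; exact: differentiableM.
by apply: eq_bigr => k _; rewrite partialM // !mxE.
Qed.

Lemma mxpartial_tr (R : realType) (m p q : nat) (l : 'I_m)
    (A : 'rV[R]_m -> 'M[R]_(p, q)) (x : 'rV[R]_m) :
  mxpartial l (fun y => (A y)^T) x = (mxpartial l A x)^T.
Proof.
by apply/matrixP => i j; rewrite !mxE; under [fun y => _]funext do rewrite mxE.
Qed.

(** The part of the definition of a Riemannian metric that the coordinate
    computations below rely on: nondegeneracy stands in for positivity. *)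
Definition metric_on (R : realType) (n : nat) (V : set 'rV[R]_n)
    (g : 'rV[R]_n -> 'M[R]_n) : Prop :=
  [/\ open V,
      forall i j, smooth_on V (fun x => g x i j),
      forall x, V x -> forall i j, g x i j = g x j i &
      forall x, V x -> g x \in unitmx].

(** The Christoffel symbols of the first kind, [Gamma_{d,ab}]. *)
Definition christoffel1 (R : realType) (n : nat) (g : 'rV[R]_n -> 'M[R]_n)
    (d a b : 'I_n) (x : 'rV[R]_n) : R :=
  2^-1 * (partial a (fun y => g y b d) x + partial b (fun y => g y a d) x
          - partial d (fun y => g y a b) x).

Lemma christoffelE (R : realType) (n : nat) (g : 'rV[R]_n -> 'M[R]_n)
    (c a b : 'I_n) :
  christoffel g c a b =
  fun x => \sum_(d < n) ginv g x c d * christoffel1 g d a b x.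
Proof.
by apply/funext => x; rewrite /christoffel mulr_sumr; apply: eq_bigr => d _;
  rewrite mulrCA.
Qed.

Lemma partial_metricC (R : realType) (n : nat) (V : set 'rV[R]_n)
    (g : 'rV[R]_n -> 'M[R]_n) (a b c : 'I_n) (x : 'rV[R]_n) :
  metric_on V g -> V x ->
  partial c (fun y => g y a b) x = partial c (fun y => g y b a) x.
Proof.
move=> [Vo _ gC _] Vx; apply: partial_near_eq; near=> y; apply: gC.
by near: y; exact: open_nbhs_nbhs.
Unshelve. all: by end_near.
Qed.

Lemma christoffel1C (R : realType) (n : nat) (V : set 'rV[R]_n)
    (g : 'rV[R]_n -> 'M[R]_n) (d a b : 'I_n) (x : 'rV[R]_n) :
  metric_on V g -> V x -> christoffel1 g d a b x = christoffel1 g d b a x.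
Proof.
move=> gV Vx; rewrite /christoffel1 (partial_metricC b a d gV Vx).
by congr (_ * (_ - _)); rewrite addrC.
Qed.

Lemma christoffelC (R : realType) (n : nat) (V : set 'rV[R]_n)
    (g : 'rV[R]_n -> 'M[R]_n) (c a b : 'I_n) (x : 'rV[R]_n) :
  metric_on V g -> V x -> christoffel g c a b x = christoffel g c b a x.
Proof.
move=> gV Vx; rewrite !christoffelE; apply: eq_bigr => d _.
by rewrite (christoffel1C _ a b gV Vx).
Qed.

Lemma lower_christoffel (R : realType) (n : nat) (V : set 'rV[R]_n)
    (g : 'rV[R]_n -> 'M[R]_n) (d a b : 'I_n) (x : 'rV[R]_n) :
  metric_on V g -> V x ->
  \sum_(c < n) g x d c * christoffel g c a b x = christoffel1 g d a b x.
Proof.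
move=> [_ _ _ gU] Vx.
have /matrixP gK := mulmxV (gU x Vx).
under eq_bigr do rewrite christoffelE mulr_sumr.
rewrite exchange_big /= (bigD1 d) //= [X in _ + X]big1 ?addr0.
  have := gK d d; rewrite !mxE eqxx => dd.
  by under eq_bigr do rewrite mulrA; rewrite -mulr_suml dd mul1r.
move=> e ed; have := gK d e; rewrite !mxE eq_sym (negPf ed) => de.
by under eq_bigr do rewrite mulrA; rewrite -mulr_suml de mul0r.
Qed.

(** Compatibility of the Levi-Civita connection with the metric. *)
Lemma partial_metricE (R : realType) (n : nat) (V : set 'rV[R]_n)
    (g : 'rV[R]_n -> 'M[R]_n) (a b c : 'I_n) (x : 'rV[R]_n) :
  metric_on V g -> V x ->
  partial c (fun y => g y a b) x =
  christoffel1 g a c b x + christoffel1 g b c a x.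
Proof.
move=> gV Vx; rewrite /christoffel1 (partial_metricC b a c gV Vx).
by field.
Qed.

Lemma differentiable_christoffel1 (R : realType) (n : nat) (V : set 'rV[R]_n)
    (g : 'rV[R]_n -> 'M[R]_n) (d a b : 'I_n) (x : 'rV[R]_n) :
  metric_on V g -> V x -> differentiable (christoffel1 g d a b) x.
Proof.
move=> [_ gs _ _] Vx.
have gd i j k : differentiable (partial i (fun y => g y j k)) x.
  exact: smooth_on_differentiable (smooth_on_partial i (gs j k)) Vx.
apply: differentiableM; first exact: differentiable_cst.
by apply: differentiableB => //; exact: differentiableD.
Qed.

Lemma differentiable_christoffel (R : realType) (n : nat) (V : set 'rV[R]_n)
    (g : 'rV[R]_n -> 'M[R]_n) (c a b : 'I_n) (x : 'rV[R]_n) :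
  metric_on V g -> V x -> differentiable (christoffel g c a b) x.
Proof.
move=> gV Vx; rewrite christoffelE; apply: differentiable_bigsum => d.
apply: differentiableM; last exact: differentiable_christoffel1 gV Vx.
have [Vo gs _ gU] := gV; apply: differentiable_invmx.
  by near=> y; apply: gU; near: y; exact: open_nbhs_nbhs.
by move=> i j; exact: smooth_on_differentiable (gs i j) Vx.
Unshelve. all: by end_near.
Qed.

(** With the first index lowered, the derivatives of the inverse metric
    disappear: [g_pa d_j Gamma^a_ik = d_j Gamma_{p,ik} - (d_j g_pa) Gamma^a_ik], and
    the summand [Gamma_{p,ja}] of [d_j g_pa] cancels the quadratic term of
    the curvature. *)
Lemma riemannE (R : realType) (n : nat) (V : set 'rV[R]_n)
    (g : 'rV[R]_n -> 'M[R]_n) (p i j k : 'I_n) (x : 'rV[R]_n) :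
  metric_on V g -> V x ->
  let T j k := partial j (christoffel1 g p i k) x -
    \sum_(a < n) christoffel1 g a j p x * christoffel g a i k x in
  riemann g p i j k x = T j k - T k j.
Proof.
move=> gV Vx T.
(* Lowering the terms of riemann_up that j and k enter in this order gives T j k;
   the others are these with j and k exchanged. *)
suff TE j' k' : T j' k' = \sum_(a < n) g x p a *
    (partial j' (christoffel g a i k') x +
     \sum_(b < n) christoffel g a j' b x * christoffel g b i k' x).
  rewrite !TE -sumrB; apply: eq_bigr => a _; rewrite -mulrBr /riemann_up.
  by rewrite sumrB opprD addrACA.
rewrite /T; have [Vo gs _ _] := gV.
have -> : partial j' (christoffel1 g p i k') x =
    \sum_(a < n) (partial j' (fun y => g y p a) x * christoffel g a i k' x +
                  g x p a * partial j' (christoffel g a i k') x).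
  have gd a : differentiable (fun y => g y p a) x.
    exact: smooth_on_differentiable (gs _ _) Vx.
  have cd a : differentiable (christoffel g a i k') x.
    exact: differentiable_christoffel gV Vx.
  under eq_bigr do rewrite -partialM //.
  rewrite -partial_sum; last by move=> a; exact: differentiableM.
  apply: partial_near_eq; near=> y; rewrite (lower_christoffel _ _ _ gV) //.
  by near: y; exact: open_nbhs_nbhs.
under [RHS]eq_bigr do rewrite mulrDr mulr_sumr.
rewrite !big_split /= exchange_big /= addrAC addrC; congr (_ + _).
rewrite -sumrB; apply: eq_bigr => a _.
under eq_bigr do rewrite mulrA.
rewrite -mulr_suml (lower_christoffel _ _ _ gV) // -mulrBl.
by rewrite (partial_metricE _ _ _ gV) // addrK.
Unshelve. all: by end_near.
Qed.

(** * Covariant differentiation along a map *)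

(** Row [i] is the velocity [F_i] of the [i]-th coordinate line. *)
Definition jac (R : realType) (m n : nat) (F : 'rV[R]_m -> 'rV[R]_n)
    (x : 'rV[R]_m) : 'M[R]_(m, n) :=
  \matrix_(i < m, a < n) partial i (fun y => F y ord0 a) x.

Definition smooth_between (R : realType) (m n : nat) (U : set 'rV[R]_m)
    (V : set 'rV[R]_n) (F : 'rV[R]_m -> 'rV[R]_n) : Prop :=
  [/\ open U, smooth_map_on U F & forall x, U x -> V (F x)].

(** The matrix of the Levi-Civita connection pulled back along [F], evaluated on
    the [l]-th coordinate field. Vectors being rows, it acts on the right. *)
Definition connection_mx (R : realType) (m n : nat) (g : 'rV[R]_n -> 'M[R]_n)
    (F : 'rV[R]_m -> 'rV[R]_n) (l : 'I_m) (x : 'rV[R]_m) : 'M[R]_n :=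
  \matrix_(d, a) \sum_(c < n) christoffel g a c d (F x) * jac F x l c.

(** [D_l X]; each row of [X] is a vector field along [F]. *)
Definition covderiv (R : realType) (m n p : nat) (g : 'rV[R]_n -> 'M[R]_n)
    (F : 'rV[R]_m -> 'rV[R]_n) (l : 'I_m) (X : 'rV[R]_m -> 'M[R]_(p, n))
    (x : 'rV[R]_m) : 'M[R]_(p, n) :=
  mxpartial l X x + X x *m connection_mx g F l x.

(** [A_ij = D_j F_i]. For an isometric immersion this is the second
    fundamental form. *)
Definition map_hessian (R : realType) (m n : nat) (g : 'rV[R]_n -> 'M[R]_n)
    (F : 'rV[R]_m -> 'rV[R]_n) (i j : 'I_m) (x : 'rV[R]_m) : 'rV[R]_n :=
  covderiv g F j (fun y => row i (jac F y)) x.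

(** The curvature operator [v |-> R(F_j, F_k) v] on row vectors. *)
Definition curvature_mx (R : realType) (m n : nat) (g : 'rV[R]_n -> 'M[R]_n)
    (F : 'rV[R]_m -> 'rV[R]_n) (j k : 'I_m) (x : 'rV[R]_m) : 'M[R]_n :=
  \matrix_(d, a) \sum_(c < n) \sum_(e < n)
     riemann_up g a d c e (F x) * jac F x j c * jac F x k e.

Lemma near_open (R : realType) (m : nat) (U : set 'rV[R]_m)
    (P : set 'rV[R]_m) (x : 'rV[R]_m) :
  open U -> U x -> (forall y, U y -> P y) -> \near x, P x.
Proof.
by move=> Uo Ux UP; near=> y; apply: UP; near: y; exact: open_nbhs_nbhs.
Unshelve. all: by end_near.
Qed.

Lemma jac_differentiable (R : realType) (m n : nat) (U : set 'rV[R]_m)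
    (V : set 'rV[R]_n) (F : 'rV[R]_m -> 'rV[R]_n) (x : 'rV[R]_m) :
  smooth_between U V F -> U x -> mxdifferentiable (jac F) x.
Proof.
move=> [_ Fs _] Ux i a; under [fun y => _]funext do rewrite mxE.
exact: smooth_on_differentiable (smooth_on_partial i (Fs a)) Ux.
Qed.

Lemma row_jac_differentiable (R : realType) (m n : nat) (U : set 'rV[R]_m)
    (V : set 'rV[R]_n) (F : 'rV[R]_m -> 'rV[R]_n) (i : 'I_m) (x : 'rV[R]_m) :
  smooth_between U V F -> U x -> mxdifferentiable (fun y => row i (jac F y)) x.
Proof.
move=> FUV Ux k a; under [fun y => _]funext do rewrite mxE.
exact: jac_differentiable FUV Ux _ _.
Qed.

Lemma mxpartial_row_jac_differentiable (R : realType) (m n : nat)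
    (U : set 'rV[R]_m) (V : set 'rV[R]_n) (F : 'rV[R]_m -> 'rV[R]_n)
    (i j : 'I_m) (x : 'rV[R]_m) :
  smooth_between U V F -> U x ->
  mxdifferentiable (mxpartial j (fun y => row i (jac F y))) x.
Proof.
move=> [_ Fs _] Ux k a; under [fun y => _]funext => y.
  rewrite mxE; under [fun z => _]funext do rewrite !mxE; over.
apply: smooth_on_differentiable (Ux).
exact: smooth_on_partial (smooth_on_partial i (Fs a)).
Qed.

Lemma mxpartial_row_jacC (R : realType) (m n : nat)
    (U : set 'rV[R]_m) (V : set 'rV[R]_n) (F : 'rV[R]_m -> 'rV[R]_n)
    (i j : 'I_m) (x : 'rV[R]_m) :
  smooth_between U V F -> U x ->
  mxpartial j (fun y => row i (jac F y)) x =
  mxpartial i (fun y => row j (jac F y)) x.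
Proof.
move=> [Uo Fs _] Ux; apply/matrixP => k a; rewrite !mxE.
have E i' : (fun y => row i' (jac F y) k a) = partial i' (fun y => F y ord0 a).
  by apply/funext => y; rewrite !mxE.
by rewrite !E; exact: smooth_on_partialC (Fs a) Ux.
Qed.

(** The pulled-back connection is compatible with the metric. *)
Lemma mxpartial_metric (R : realType) (m n : nat) (U : set 'rV[R]_m)
    (V : set 'rV[R]_n) (g : 'rV[R]_n -> 'M[R]_n) (F : 'rV[R]_m -> 'rV[R]_n)
    (l : 'I_m) (x : 'rV[R]_m) :
  metric_on V g -> smooth_between U V F -> U x ->
  mxpartial l (fun y => g (F y)) x =
  connection_mx g F l x *m g (F x) + g (F x) *m (connection_mx g F l x)^T.
Proof.
move=> gV [Uo Fs FV] Ux; have VF := FV _ Ux; have [Vo gs gC _] := gV.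
have Fd a : differentiable (fun y => F y ord0 a) x.
  exact: smooth_on_differentiable (Fs a) Ux.
have lower a b : (g (F x) *m (connection_mx g F l x)^T) a b =
    \sum_(c < n) christoffel1 g a c b (F x) * jac F x l c.
  rewrite !mxE; under eq_bigr do rewrite !mxE mulr_sumr.
  rewrite exchange_big; apply: eq_bigr => c _ /=.
  under eq_bigr do rewrite mulrA.
  by rewrite -mulr_suml (lower_christoffel _ _ _ gV).
apply/matrixP => a b; rewrite [RHS]mxE lower.
have -> : (connection_mx g F l x *m g (F x)) a b =
    (g (F x) *m (connection_mx g F l x)^T) b a.
  rewrite !mxE; apply: eq_bigr => c _.
  by rewrite mulrC gC // [in RHS]mxE.
rewrite lower mxE (@partial_comp _ _ _ l F (fun z => g z a b)) //; last first.
  exact: smooth_on_differentiable (gs a b) VF.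
rewrite -big_split; apply: eq_bigr => c _ /=.
by rewrite (partial_metricE _ _ _ gV) // -mulrDl mxE addrC.
Qed.

Lemma connection_mx_differentiable (R : realType) (m n : nat) (U : set 'rV[R]_m)
    (V : set 'rV[R]_n) (g : 'rV[R]_n -> 'M[R]_n) (F : 'rV[R]_m -> 'rV[R]_n)
    (l : 'I_m) (x : 'rV[R]_m) :
  metric_on V g -> smooth_between U V F -> U x ->
  mxdifferentiable (connection_mx g F l) x.
Proof.
move=> gV FUV Ux a b; have [Uo Fs FV] := FUV.
under [fun y => _]funext do rewrite mxE.
apply: differentiable_bigsum => c; apply: differentiableM.
  apply: differentiable_comp_rV.
    by move=> d; exact: smooth_on_differentiable (Fs d) Ux.
  exact: differentiable_christoffel gV (FV _ Ux).
exact: jac_differentiable FUV Ux _ _.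
Qed.

Lemma metric_comp_differentiable (R : realType) (m n : nat) (U : set 'rV[R]_m)
    (V : set 'rV[R]_n) (g : 'rV[R]_n -> 'M[R]_n) (F : 'rV[R]_m -> 'rV[R]_n)
    (x : 'rV[R]_m) :
  metric_on V g -> smooth_between U V F -> U x ->
  mxdifferentiable (fun y => g (F y)) x.
Proof.
move=> [_ gs _ _] [_ Fs FV] Ux a b.
apply: (@differentiable_comp_rV _ _ _ F (fun z => g z a b)).
  by move=> d; exact: smooth_on_differentiable (Fs d) Ux.
exact: smooth_on_differentiable (gs a b) (FV _ Ux).
Qed.

Lemma mxpartial_dot (R : realType) (m n p q : nat) (U : set 'rV[R]_m)
    (V : set 'rV[R]_n) (g : 'rV[R]_n -> 'M[R]_n) (F : 'rV[R]_m -> 'rV[R]_n)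
    (l : 'I_m) (X : 'rV[R]_m -> 'M[R]_(p, n)) (Y : 'rV[R]_m -> 'M[R]_(q, n))
    (x : 'rV[R]_m) :
  metric_on V g -> smooth_between U V F -> U x ->
  mxdifferentiable X x -> mxdifferentiable Y x ->
  mxpartial l (fun y => X y *m g (F y) *m (Y y)^T) x =
  covderiv g F l X x *m g (F x) *m (Y x)^T +
  X x *m g (F x) *m (covderiv g F l Y x)^T.
Proof.
move=> gV FUV Ux Xd Yd.
have gFd := metric_comp_differentiable gV FUV Ux.
rewrite mxpartialM; [|exact: mxdifferentiableM|exact: mxdifferentiable_tr].
rewrite mxpartialM // mxpartial_tr (mxpartial_metric _ gV FUV) //.
rewrite /covderiv [(_ + _)^T]linearD /= trmx_mul !mulmxDl !mulmxDr !mulmxA.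
by rewrite mulmxDl -!addrA; congr (_ + (_ + _)); rewrite addrC.
Qed.

(** The connection is torsion free and second derivatives commute. *)
Lemma map_hessianC (R : realType) (m n : nat) (U : set 'rV[R]_m)
    (V : set 'rV[R]_n) (g : 'rV[R]_n -> 'M[R]_n) (F : 'rV[R]_m -> 'rV[R]_n)
    (i j : 'I_m) (x : 'rV[R]_m) :
  metric_on V g -> smooth_between U V F -> U x ->
  map_hessian g F i j x = map_hessian g F j i x.
Proof.
move=> gV FUV Ux; have [_ _ FV] := FUV.
rewrite /map_hessian /covderiv (mxpartial_row_jacC _ _ FUV) //; congr (_ + _).
apply/matrixP => k a; rewrite !mxE.
under eq_bigr do rewrite !mxE mulr_sumr.
rewrite exchange_big; apply: eq_bigr => c _; rewrite !mxE mulr_sumr.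
apply: eq_bigr => d _; rewrite !mxE (christoffelC _ _ _ gV (FV _ Ux)).
by rewrite mulrCA [RHS]mulrCA [X in _ * X]mulrC.
Qed.

Lemma map_hessian_differentiable (R : realType) (m n : nat) (U : set 'rV[R]_m)
    (V : set 'rV[R]_n) (g : 'rV[R]_n -> 'M[R]_n) (F : 'rV[R]_m -> 'rV[R]_n)
    (i j : 'I_m) (x : 'rV[R]_m) :
  metric_on V g -> smooth_between U V F -> U x ->
  mxdifferentiable (map_hessian g F i j) x.
Proof.
move=> gV FUV Ux; apply: mxdifferentiableD.
  exact: mxpartial_row_jac_differentiable FUV Ux.
apply: mxdifferentiableM; first exact: row_jac_differentiable FUV Ux.
exact: connection_mx_differentiable gV FUV Ux.
Qed.

(** The curvature of the pulled-back connection is the pullback of the curvature: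
    the second derivatives of [F] in [d_j W_k] are symmetric in [j] and [k], hence
    drop out. *)
Lemma curvature_mxE (R : realType) (m n : nat) (U : set 'rV[R]_m)
    (V : set 'rV[R]_n) (g : 'rV[R]_n -> 'M[R]_n) (F : 'rV[R]_m -> 'rV[R]_n)
    (j k : 'I_m) (x : 'rV[R]_m) :
  metric_on V g -> smooth_between U V F -> U x ->
  mxpartial j (connection_mx g F k) x - mxpartial k (connection_mx g F j) x
  + connection_mx g F k x *m connection_mx g F j x
  - connection_mx g F j x *m connection_mx g F k x =
  curvature_mx g F j k x.
Proof.
move=> gV FUV Ux; have [Uo Fs FV] := FUV; have VF := FV _ Ux.
have Fd a : differentiable (fun y => F y ord0 a) x.
  exact: smooth_on_differentiable (Fs a) Ux.
have Gd a b c : differentiable (christoffel g a b c) (F x).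
  exact: differentiable_christoffel gV VF.
have dGC a c d e : partial c (christoffel g a e d) (F x) =
    partial c (christoffel g a d e) (F x).
  apply: partial_near_eq; have [Vo _ _ _] := gV.
  by apply: near_open Vo VF _ => y Vy; exact: christoffelC gV Vy.
have dW j' k' d a : mxpartial j' (connection_mx g F k') x d a =
    \sum_(c < n) \sum_(e < n) partial c (christoffel g a d e) (F x) *
       jac F x j' c * jac F x k' e +
    \sum_(e < n) christoffel g a e d (F x) * partial j' (fun y => jac F y k' e) x.
  rewrite mxE; under [fun y => _]funext do rewrite mxE.
  have cd e : differentiable (fun y => christoffel g a e d (F y)) x.
    exact: differentiable_comp_rV.
  have jd e : differentiable (fun y => jac F y k' e) x.
    exact: jac_differentiable FUV Ux _ _.
  rewrite partial_sum; last by move=> e; exact: differentiableM.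
  rewrite [X in _ = X + _]exchange_big -big_split; apply: eq_bigr => e _ /=.
  rewrite partialM // partial_comp // mulr_suml; congr (_ + _).
  by apply: eq_bigr => c _; rewrite dGC [jac F x j' c]mxE.
have WW j' k' d a : (connection_mx g F k' x *m connection_mx g F j' x) d a =
    \sum_(c < n) \sum_(e < n) (\sum_(b < n) christoffel g a c b (F x) *
       christoffel g b d e (F x)) * jac F x j' c * jac F x k' e.
  rewrite mxE.
  under eq_bigr => b _.
    rewrite !mxE mulr_sumr; under eq_bigr do rewrite mulr_suml; over.
  rewrite exchange_big; apply: eq_bigr => c _ /=.
  rewrite exchange_big; apply: eq_bigr => e _ /=.
  rewrite !mulr_suml; apply: eq_bigr => b _.
  by rewrite (christoffelC b e d gV) //; ring.
have FC e : partial j (fun y => jac F y k e) x = partial k (fun y => jac F y j e) x.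
  have E i' : (fun y => jac F y i' e) = partial i' (fun y => F y ord0 e).
    by apply/funext => y; rewrite !mxE.
  by rewrite !E; exact: smooth_on_partialC (Fs e) Ux.
have swap (f : 'I_n -> 'I_n -> R) : \sum_(c < n) \sum_(e < n)
      f c e * jac F x k c * jac F x j e =
    \sum_(c < n) \sum_(e < n) f e c * jac F x j c * jac F x k e.
  rewrite exchange_big; apply: eq_bigr => c _; apply: eq_bigr => e _ /=.
  by rewrite mulrAC.
have subE (A B C D : 'M[R]_n) d a :
    (A - B + C - D) d a = A d a - B d a + C d a - D d a by rewrite !mxE.
have cancelE (A B C D H : R) : A + H - (B + H) + C - D = A - B + (C - D).
  by rewrite opprD addrACA subrr addr0 addrA.
apply/matrixP => d a; rewrite subE !dW !WW !swap.
have -> : \sum_(e < n) christoffel g a e d (F x) * partial j (fun y => jac F y k e) x =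
    \sum_(e < n) christoffel g a e d (F x) * partial k (fun y => jac F y j e) x.
  by apply: eq_bigr => e _; rewrite (FC e).
rewrite cancelE mxE -!sumrB -big_split; apply: eq_bigr => c _ /=.
rewrite -!sumrB -big_split; apply: eq_bigr => e _ /=.
by rewrite /riemann_up sumrB -!mulrBl -!mulrDl.
Qed.

(** * The Gauss equation *)

Lemma mxpartial2_row_jacC (R : realType) (m n : nat)
    (U : set 'rV[R]_m) (V : set 'rV[R]_n) (F : 'rV[R]_m -> 'rV[R]_n)
    (i j k : 'I_m) (x : 'rV[R]_m) :
  smooth_between U V F -> U x ->
  mxpartial j (mxpartial k (fun y => row i (jac F y))) x =
  mxpartial k (mxpartial j (fun y => row i (jac F y))) x.
Proof.
move=> [Uo Fs _] Ux; pose D k' := mxpartial k' (fun y => row i (jac F y)).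
have E j' k' b a : mxpartial j' (D k') x b a =
    partial j' (partial k' (partial i (fun y => F y ord0 a))) x.
  rewrite mxpartialE; congr (partial j' _ x); apply/funext => y.
  by rewrite mxpartialE; congr (partial k' _ y); apply/funext => z; rewrite !mxE.
apply/matrixP => b a; apply: etrans (E j k b a) (etrans _ (esym (E k j b a))).
exact: smooth_on_partialC (smooth_on_partial i (Fs a)) Ux.
Qed.

(** The Ricci identity for [F_i]: since [A_ik = D_k F_i], the left-hand side is
    the commutator of [D_j] and [D_k]. *)
Lemma covderiv_map_hessianB (R : realType) (m n : nat) (U : set 'rV[R]_m)
    (V : set 'rV[R]_n) (g : 'rV[R]_n -> 'M[R]_n) (F : 'rV[R]_m -> 'rV[R]_n)
    (i j k : 'I_m) (x : 'rV[R]_m) :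
  metric_on V g -> smooth_between U V F -> U x ->
  covderiv g F j (map_hessian g F i k) x - covderiv g F k (map_hessian g F i j) x
  = row i (jac F x) *m curvature_mx g F j k x.
Proof.
move=> gV FUV Ux.
pose X y := row i (jac F y).
have Xd : mxdifferentiable X x := row_jac_differentiable i FUV Ux.
have Wd l := connection_mx_differentiable l gV FUV Ux.
have dA j' k' : covderiv g F j' (map_hessian g F i k') x =
    mxpartial j' (mxpartial k' X) x
    + (mxpartial j' X x *m connection_mx g F k' x +
       mxpartial k' X x *m connection_mx g F j' x)
    + X x *m (mxpartial j' (connection_mx g F k') x +
              connection_mx g F k' x *m connection_mx g F j' x).
  rewrite /covderiv /map_hessian mxpartialD; first last.
  - exact: mxdifferentiableM.
  - exact: mxpartial_row_jac_differentiable FUV Ux.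
  rewrite mxpartialM // mulmxDl mulmxDr mulmxA -!addrA; congr (_ + (_ + _)).
  by rewrite addrCA.
rewrite !dA (mxpartial2_row_jacC i j k FUV Ux) -(curvature_mxE j k gV FUV Ux).
have cancelE (S a b p q : 'rV[R]_n) : S + (a + b) + p - (S + (b + a) + q) = p - q.
  by rewrite (addrC b a) opprD addrACA subrr add0r.
rewrite cancelE -mulmxBr opprD addrA; congr (_ *m (_ - _)).
exact: addrAC.
Qed.

Definition dot (R : realType) (n : nat) (G : 'M[R]_n) (u v : 'rV[R]_n) : R :=
  (u *m G *m v^T) ord0 ord0.

Lemma dotC (R : realType) (n : nat) (G : 'M[R]_n) (u v : 'rV[R]_n) :
  G^T = G -> dot G u v = dot G v u.
Proof.
move=> GT; rewrite /dot.
rewrite -[u *m G *m v^T]trmxK mxE.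
by rewrite trmx_mul trmxK trmx_mul GT mulmxA.
Qed.

Lemma dotBr (R : realType) (n : nat) (G : 'M[R]_n) (u v w : 'rV[R]_n) :
  dot G u (v - w) = dot G u v - dot G u w.
Proof. by rewrite /dot linearB /= mulmxBr !mxE. Qed.

Lemma partial_dot (R : realType) (m n : nat) (U : set 'rV[R]_m)
    (V : set 'rV[R]_n) (g : 'rV[R]_n -> 'M[R]_n) (F : 'rV[R]_m -> 'rV[R]_n)
    (l : 'I_m) (X Y : 'rV[R]_m -> 'rV[R]_n) (x : 'rV[R]_m) :
  metric_on V g -> smooth_between U V F -> U x ->
  mxdifferentiable X x -> mxdifferentiable Y x ->
  partial l (fun y => dot (g (F y)) (X y) (Y y)) x =
  dot (g (F x)) (covderiv g F l X x) (Y x) +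
  dot (g (F x)) (X x) (covderiv g F l Y x).
Proof.
move=> gV FUV Ux Xd Yd.
have /matrixP/(_ ord0 ord0) := mxpartial_dot l gV FUV Ux Xd Yd.
by rewrite mxpartialE [RHS]mxE.
Qed.

Definition pullback_metric (R : realType) (m n : nat)
    (g : 'rV[R]_n -> 'M[R]_n) (F : 'rV[R]_m -> 'rV[R]_n) (x : 'rV[R]_m) :
    'M[R]_m :=
  jac F x *m g (F x) *m (jac F x)^T.

Lemma pullback_metricE (R : realType) (m n : nat) (g : 'rV[R]_n -> 'M[R]_n)
    (F : 'rV[R]_m -> 'rV[R]_n) (x : 'rV[R]_m) (i j : 'I_m) :
  pullback_metric g F x i j =
  dot (g (F x)) (row i (jac F x)) (row j (jac F x)).
Proof.
by rewrite /dot -row_mul mxE [RHS]mxE; apply: eq_bigr => b _; rewrite !mxE.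
Qed.

(** The computation that determines the Levi-Civita connection: the three
    derivatives [d_l gb_ij = <A_il, F_j> + <F_i, A_jl>] combine, [A] being
    symmetric, to twice [<F_k, A_ij>]. *)
Lemma christoffel1_pullback (R : realType) (m n : nat) (U : set 'rV[R]_m)
    (V : set 'rV[R]_n) (g : 'rV[R]_n -> 'M[R]_n) (gb : 'rV[R]_m -> 'M[R]_m)
    (F : 'rV[R]_m -> 'rV[R]_n) (k i j : 'I_m) (x : 'rV[R]_m) :
  metric_on V g -> smooth_between U V F ->
  (forall y, U y -> gb y = pullback_metric g F y) -> U x ->
  christoffel1 gb k i j x =
  dot (g (F x)) (row k (jac F x)) (map_hessian g F i j x).
Proof.
move=> gV FUV gbE Ux; have [Uo Fs FV] := FUV; have [_ _ gC _] := gV.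
have gT : (g (F x))^T = g (F x).
  by apply/matrixP => a b; rewrite mxE gC //; exact: FV.
have dgb l i' j' : partial l (fun y => gb y i' j') x =
    dot (g (F x)) (row j' (jac F x)) (map_hessian g F i' l x) +
    dot (g (F x)) (row i' (jac F x)) (map_hessian g F j' l x).
  rewrite [X in X + _]dotC // -(partial_dot _ gV FUV) //; first last.
  - exact: row_jac_differentiable FUV Ux.
  - exact: row_jac_differentiable FUV Ux.
  apply: partial_near_eq; apply: near_open Uo Ux _ => y Uy.
  by rewrite gbE // pullback_metricE.
rewrite /christoffel1 !dgb !(map_hessianC k _ gV FUV) // (map_hessianC j i gV FUV) //.
by field.
Qed.

(** The inner product of the components of [u] and [v] orthogonal to the rows
    of [P]: subtracted from [<u, v>] is the inner product of their projections on
    the row space, whose Gram matrix is [P *m G *m P^T]. *)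
Definition normal_dot (R : realType) (m n : nat) (G : 'M[R]_n) (P : 'M[R]_(m, n))
    (u v : 'rV[R]_n) : R :=
  dot G u v - \sum_(a < m) dot G (row a P) u *
    \sum_(b < m) invmx (P *m G *m P^T) a b * dot G (row b P) v.

(** In [riemannE] for the induced metric, [d_j Gamma_{p,ik}] is
    [<A_pj, A_ik> + <F_p, D_j A_ik>], and the product of Christoffel symbols is the
    tangential part of the first of these terms, which leaves its normal part.
    Antisymmetrizing the second term in [j] and [k] gives the curvature of the
    ambient space. *)
Lemma gauss_equation (R : realType) (m n : nat) (U : set 'rV[R]_m)
    (V : set 'rV[R]_n) (g : 'rV[R]_n -> 'M[R]_n) (gb : 'rV[R]_m -> 'M[R]_m)
    (F : 'rV[R]_m -> 'rV[R]_n) (p i j k : 'I_m) (x : 'rV[R]_m) :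
  metric_on V g -> metric_on U gb -> smooth_between U V F ->
  (forall y, U y -> gb y = pullback_metric g F y) -> U x ->
  let A := fun i j => map_hessian g F i j x in
  let Q := normal_dot (g (F x)) (jac F x) in
  riemann gb p i j k x =
  dot (g (F x)) (row p (jac F x)) (row i (jac F x) *m curvature_mx g F j k x)
  + Q (A p j) (A i k) - Q (A p k) (A i j).
Proof.
move=> gV gbU FUV gbE Ux A Q; have [Uo Fs FV] := FUV.
have G1 k' i' j' y := christoffel1_pullback k' i' j' gV FUV gbE (x := y).
have dG j' k' : partial j' (christoffel1 gb p i k') x =
    dot (g (F x)) (A p j') (A i k') +
    dot (g (F x)) (row p (jac F x)) (covderiv g F j' (map_hessian g F i k') x).
  apply: etrans (partial_dot j' gV FUV Ux (row_jac_differentiable p FUV Ux)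
    (map_hessian_differentiable i k' gV FUV Ux)).
  by apply: partial_near_eq; apply: near_open Uo Ux _ => y; exact: G1.
(* The product of Christoffel symbols of the induced metric is the tangential
   part of the first summand of dG. *)
have T j' k' : partial j' (christoffel1 gb p i k') x -
    \sum_(a < m) christoffel1 gb a j' p x * christoffel gb a i k' x =
    Q (A p j') (A i k') +
    dot (g (F x)) (row p (jac F x)) (covderiv g F j' (map_hessian g F i k') x).
  rewrite dG addrAC; congr (_ - _ + _); apply: eq_bigr => a _.
  rewrite G1 // (map_hessianC j' p gV FUV) // christoffelE; congr (_ * _).
  by apply: eq_bigr => b _; rewrite G1 // /ginv gbE.
apply: etrans (riemannE p i j k gbU Ux) _.
apply: etrans (congr2 (fun a b => a - b) (T j k) (T k j)) _.
rewrite -(covderiv_map_hessianB i j k gV FUV Ux) dotBr.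
by rewrite opprD addrACA addrC addrA.
Qed.

(** The vector [N := w *m invmx G], normal to the rows of [P], completes them to
    a basis, in which [G] is block diagonal. Therefore
    [invmx G = P^T (P G P^T)^-1 P + N^T N / <N, N>], which is checked by multiplying
    on the left by the invertible matrix [B *m G], [B] having [N] and the rows of
    [P] as rows. *)
Lemma codim1_normal_dot (R : realType) (m : nat) (G : 'M[R]_m.+1)
    (P : 'M[R]_(m, m.+1)) (w u v : 'rV[R]_m.+1) :
  G^T = G -> G \in unitmx -> P *m G *m P^T \in unitmx ->
  P *m w^T = 0 -> dot (invmx G) w w != 0 ->
  normal_dot G P u v =
  (u *m w^T) ord0 ord0 * (v *m w^T) ord0 ord0 / dot (invmx G) w w.
Proof.
move=> GT GU PU Pw; set c := dot _ w w => c0.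
pose N := w *m invmx G.
pose Z := invmx G - P^T *m invmx (P *m G *m P^T) *m P - c^-1 *: (N^T *m N).
have GVT : (invmx G)^T = invmx G by rewrite trmx_inv GT.
have NT : N^T = invmx G *m w^T by rewrite trmx_mul GVT.
have cE : N *m w^T = c%:M by rewrite [LHS]mx11_scalar.
have wP : w *m P^T = 0 by apply: trmx_inj; rewrite trmx_mul trmxK Pw trmx0.
have NG : N *m G = w by rewrite mulmxKV.
have GN : G *m N^T = w^T by rewrite NT mulKVmx.
pose B : 'M[R]_(1 + m, m.+1) := col_mx N P.
have BGBT : B *m G *m B^T = block_mx c%:M 0 0 (P *m G *m P^T).
  rewrite /B tr_col_mx mul_col_mx mul_col_row NG wP -(mulmxA P) GN Pw.
  by rewrite -cE -{1}NG -mulmxA GN.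
have BU : (B : 'M_m.+1) \in unitmx.
  have : (B : 'M_m.+1) *m G *m (B : 'M_m.+1)^T \in unitmx.
    have := det_ublock (c%:M : 'M_1) 0 (P *m G *m P^T).
    rewrite -BGBT det_scalar1 unitmxE => ->.
    by rewrite unitrM unitfE c0 -unitmxE.
  by rewrite -mulmxA unitmx_mul => /andP[].
have BGZ : B *m G *m Z = 0.
  rewrite /B !mul_col_mx NG.
  have -> : w *m Z = 0.
    rewrite !mulmxBr !mulmxA wP !mul0mx subr0 -scalemxAr NT !mulmxA.
    by rewrite -/N cE mul_scalar_mx -scalemxAl scalerA mulVf // scale1r subrr.
  have -> : P *m G *m Z = 0.
    rewrite !mulmxBr mulmxK // !mulmxA mulmxV // mul1mx subrr sub0r.
    by rewrite -scalemxAr !mulmxA -(mulmxA P) GN Pw !mul0mx scaler0 oppr0.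
  by rewrite col_mx0.
have Z0 : Z = 0.
  have BGU : (B : 'M_m.+1) *m G \in unitmx by rewrite unitmx_mul BU.
  by rewrite -[Z](mulKmx BGU) [X in _ *m X]BGZ mulmx0.
have GE : invmx G = P^T *m invmx (P *m G *m P^T) *m P + c^-1 *: (N^T *m N).
  by apply/eqP; rewrite -subr_eq0 opprD addrA -/Z Z0.
rewrite /normal_dot; have -> : dot G u v = dot (invmx G) (u *m G) (v *m G).
  by rewrite /dot trmx_mul GT mulmxK // mulmxA.
rewrite {1}/dot {1}GE mulmxDr mulmxDl mxE; set S := (X in X + _ - _).
have -> : S = \sum_(a < m) dot G (row a P) u *
    \sum_(b < m) invmx (P *m G *m P^T) a b * dot G (row b P) v.
  have dotE a z : dot G (row a P) z = (P *m G *m z^T) a ord0.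
    by rewrite /dot -!row_mul mxE.
  have -> : S = ((P *m G *m u^T)^T *m
      (invmx (P *m G *m P^T) *m (P *m G *m v^T))) ord0 ord0.
    by rewrite /S !trmx_mul !trmxK GT !mulmxA.
  rewrite mxE; apply: eq_bigr => a _; rewrite dotE [in LHS]mxE; congr (_ * _).
  by rewrite mxE; apply: eq_bigr => b _; rewrite dotE.
rewrite addrAC addrN add0r -scalemxAr -scalemxAl mxE mulrC; congr (_ * _).
have -> : u *m G *m (N^T *m N) *m (v *m G)^T = (u *m w^T) *m (v *m w^T)^T.
  rewrite !trmx_mul !trmxK GT GVT -NT !mulmxA.
  by rewrite -(mulmxA u) GN mulmxKV.
have trE (A : 'M[R]_1) : A^T = A by rewrite [A]mx11_scalar tr_scalar_mx.
by rewrite trE [LHS]mxE big_ord1.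
Qed.

(** * Level sets *)

Definition gradient_row (R : realType) (n : nat) (f : 'rV[R]_n -> R)
    (z : 'rV[R]_n) : 'rV[R]_n := \row_a partial a f z.

Definition coord_hessian (R : realType) (n : nat) (g : 'rV[R]_n -> 'M[R]_n)
    (f : 'rV[R]_n -> R) (a b : 'I_n) (z : 'rV[R]_n) : R :=
  covariant_derivative g (fun a' => partial a' f) a b z.

Lemma jac_level_set (R : realType) (m n : nat) (U : set 'rV[R]_m)
    (V : set 'rV[R]_n) (F : 'rV[R]_m -> 'rV[R]_n) (f : 'rV[R]_n -> R) (k0 : R)
    (x : 'rV[R]_m) :
  smooth_between U V F -> smooth_on V f -> (forall y, U y -> f (F y) = k0) ->
  U x -> jac F x *m (gradient_row f (F x))^T = 0.
Proof.
move=> [Uo Fs FV] fs fF Ux; apply/matrixP => i j; rewrite [RHS]mxE.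
have <- : partial i (fun y => f (F y)) x = 0.
  rewrite -(partial_cst i k0 x); apply: partial_near_eq.
  exact: near_open Uo Ux fF.
rewrite partial_comp; first last.
- exact: smooth_on_differentiable fs (FV _ Ux).
- by move=> a; exact: smooth_on_differentiable (Fs a) Ux.
by rewrite mxE; apply: eq_bigr => a _; rewrite !mxE mulrC.
Qed.

(** Apply [D_j] to [dh(F_i) = 0]. *)
Lemma map_hessian_level_set (R : realType) (m n : nat) (U : set 'rV[R]_m)
    (V : set 'rV[R]_n) (g : 'rV[R]_n -> 'M[R]_n) (F : 'rV[R]_m -> 'rV[R]_n)
    (f : 'rV[R]_n -> R) (k0 : R) (i j : 'I_m) (x : 'rV[R]_m) :
  metric_on V g -> smooth_between U V F -> smooth_on V f ->
  (forall y, U y -> f (F y) = k0) -> U x ->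
  (map_hessian g F i j x *m (gradient_row f (F x))^T) ord0 ord0 =
  - \sum_(a < n) \sum_(b < n)
      coord_hessian g f a b (F x) * jac F x i a * jac F x j b.
Proof.
move=> gV FUV fs fF Ux; have [Uo Fs FV] := FUV; have VF := FV _ Ux.
pose X y := row i (jac F y); pose D y := (gradient_row f (F y))^T.
have Fd a : differentiable (fun y => F y ord0 a) x.
  exact: smooth_on_differentiable (Fs a) Ux.
have fd a : differentiable (partial a f) (F x).
  exact: smooth_on_differentiable (smooth_on_partial a fs) VF.
have DE a b : (fun y => D y a b) = fun y => partial a f (F y).
  by apply/funext => y; rewrite !mxE.
have Dd : mxdifferentiable D x.
  by move=> a b; rewrite DE; exact: differentiable_comp_rV.
have dXD : mxpartial j (fun y => X y *m D y) x = 0.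
  rewrite (@mxpartial_near_eq _ _ _ _ _ _ (fun=> 0)).
    by apply/matrixP => a b; rewrite mxpartialE [RHS]mxE mxE partial_cst.
  apply: near_open Uo Ux _ => y Uy.
  by rewrite -row_mul (jac_level_set FUV fs fF Uy) row0.
have Xd : mxdifferentiable X x := row_jac_differentiable i FUV Ux.
move: dXD; rewrite mxpartialM // => /eqP; rewrite addr_eq0 => /eqP dXD.
rewrite /map_hessian /covderiv -/X mulmxDl -/(D x) dXD.
rewrite addrC -mulmxA -mulmxBr mxE -sumrN; apply: eq_bigr => d _.
have WD : (connection_mx g F j x *m D x) d ord0 =
    \sum_(b < n) (\sum_(a < n) christoffel g a d b (F x) * partial a f (F x)) *
      jac F x j b.
  rewrite mxE.
  under eq_bigr => a _ do rewrite [connection_mx _ _ _ _ _ _]mxE mulr_suml.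
  rewrite exchange_big; apply: eq_bigr => b _ /=; rewrite mulr_suml.
  apply: eq_bigr => a _; rewrite (christoffelC a b d gV VF) mulrAC.
  by rewrite [D x a ord0]mxE mxE.
have dD : mxpartial j D x d ord0 =
    \sum_(b < n) partial b (partial d f) (F x) * jac F x j b.
  rewrite mxpartialE DE partial_comp //; apply: eq_bigr => b _.
  by rewrite [jac _ _ _ _]mxE.
have subE (A B : 'cV[R]_n) : (A - B) d ord0 = A d ord0 - B d ord0 by rewrite !mxE.
have XE : X x ord0 d = jac F x i d by rewrite mxE.
rewrite subE XE WD dD -sumrB mulr_sumr -sumrN.
apply: eq_bigr => b _; rewrite /coord_hessian /covariant_derivative.
by ring.
Qed.

Lemma dot_curvature_mx (R : realType) (m n : nat) (g : 'rV[R]_n -> 'M[R]_n)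
    (F : 'rV[R]_m -> 'rV[R]_n) (p i j k : 'I_m) (x : 'rV[R]_m) :
  dot (g (F x)) (row p (jac F x)) (row i (jac F x) *m curvature_mx g F j k x) =
  \sum_(a1 < n) \sum_(a2 < n) \sum_(a3 < n) \sum_(a4 < n)
    riemann g a1 a2 a3 a4 (F x) * jac F x p a1 * jac F x i a2 * jac F x j a3 *
    jac F x k a4.
Proof.
have -> : dot (g (F x)) (row p (jac F x)) (row i (jac F x) *m curvature_mx g F j k x)
  = \sum_(a1 < n) jac F x p a1 * \sum_(a < n) g (F x) a1 a *
    \sum_(a2 < n) jac F x i a2 * curvature_mx g F j k x a2 a.
  rewrite /dot -mulmxA mxE; apply: eq_bigr => a1 _; rewrite [row _ _ _ _]mxE.
  congr (_ * _); rewrite mxE; apply: eq_bigr => a _; rewrite [_^T _ _]mxE.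
  by congr (_ * _); rewrite mxE; apply: eq_bigr => a2 _; rewrite [row _ _ _ _]mxE.
apply: eq_bigr => a1 _; rewrite mulr_sumr.
under eq_bigr do rewrite !mulr_sumr.
rewrite exchange_big; apply: eq_bigr => a2 _ /=.
under eq_bigr => a _.
  rewrite [curvature_mx _ _ _ _ _ _ _]mxE !mulr_sumr.
  under eq_bigr do rewrite !mulr_sumr; over.
rewrite exchange_big; apply: eq_bigr => a3 _ /=.
rewrite exchange_big; apply: eq_bigr => a4 _ /=.
by rewrite /riemann !mulr_suml; apply: eq_bigr => a _; ring.
Qed.

Lemma sum4_factor (R : realType) (n : nat) (H : 'I_n -> 'I_n -> R)
    (u v w t : 'I_n -> R) :
  \sum_(a1 < n) \sum_(a2 < n) \sum_(a3 < n) \sum_(a4 < n)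
    H a1 a3 * H a2 a4 * u a1 * v a2 * w a3 * t a4 =
  (\sum_(a < n) \sum_(b < n) H a b * u a * w b) *
  (\sum_(a < n) \sum_(b < n) H a b * v a * t b).
Proof.
rewrite mulr_suml; apply: eq_bigr => a1 _.
rewrite mulr_sumr; apply: eq_bigr => a2 _.
rewrite mulr_suml; apply: eq_bigr => a3 _.
by rewrite mulr_sumr; apply: eq_bigr => a4 _; ring.
Qed.

Lemma dotE (R : realType) (n : nat) (G : 'M[R]_n) (u v : 'rV[R]_n) :
  dot G u v = \sum_(a < n) \sum_(b < n) G a b * u ord0 a * v ord0 b.
Proof.
rewrite /dot mxE exchange_big; apply: eq_bigr => b _.
by rewrite !mxE mulr_suml; apply: eq_bigr => a _; rewrite (mulrC (u _ _)).
Qed.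

(** The normal part in the Gauss equation and the restriction of the ambient
    curvature are both multiples of [L p j * L i k - L p k * L i j], where [L] is the
    Hessian of [f] restricted to the level set; the factors are [1 / c] and
    [1 / (1 - c)]. *)
Lemma level_set_curvature (R : realType) (m : nat) (U : set 'rV[R]_m)
    (V : set 'rV[R]_m.+1) (g : 'rV[R]_m.+1 -> 'M[R]_m.+1)
    (gb : 'rV[R]_m -> 'M[R]_m) (F : 'rV[R]_m -> 'rV[R]_m.+1)
    (f : 'rV[R]_m.+1 -> R) (k0 : R) (x : 'rV[R]_m) :
  metric_on V g -> metric_on U gb -> smooth_between U V F ->
  (forall y, U y -> gb y = pullback_metric g F y) ->
  smooth_on V f -> (forall y, U y -> f (F y) = k0) -> U x ->
  let z := F x in
  let c := dot (invmx (g z)) (gradient_row f z) (gradient_row f z) in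
  c != 0 -> 1 - c != 0 ->
  (forall p i j k, riemann g p i j k z =
     (coord_hessian g f p j z * coord_hessian g f i k z
      - coord_hessian g f p k z * coord_hessian g f i j z) / (1 - c)) ->
  forall p i j k, riemann gb p i j k x =
    c^-1 * \sum_(a1 < m.+1) \sum_(a2 < m.+1) \sum_(a3 < m.+1) \sum_(a4 < m.+1)
      riemann g a1 a2 a3 a4 z * jac F x p a1 * jac F x i a2 * jac F x j a3 *
      jac F x k a4.
Proof.
move=> gV gbU FUV gbE fs fF Ux z c c0 c1 gR p i j k.
have [_ _ FV] := FUV; have Vz : V z := FV _ Ux.
have [_ _ gC gU] := gV; have [_ _ _ gbUn] := gbU.
have gT : (g z)^T = g z by apply/matrixP => a b; rewrite mxE gC.
have gbz : pullback_metric g F x \in unitmx by rewrite -gbE //; exact: gbUn.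
pose L i j := \sum_(a < m.+1) \sum_(b < m.+1)
  coord_hessian g f a b z * jac F x i a * jac F x j b.
have ndE i1 i2 i3 i4 : normal_dot (g z) (jac F x) (map_hessian g F i1 i2 x)
    (map_hessian g F i3 i4 x) = L i1 i2 * L i3 i4 / c.
  rewrite (codim1_normal_dot (w := gradient_row f z)) ?gU //.
    by rewrite !(map_hessian_level_set _ _ gV FUV fs fF) // mulrNN.
  exact: jac_level_set FUV fs fF Ux.
rewrite (gauss_equation _ _ _ _ gV gbU FUV gbE) // !ndE dot_curvature_mx -/z.
set S := \sum_(a1 < _) _.
suff -> : S = (L p j * L i k - L p k * L i j) / (1 - c).
  by field; rewrite c0 c1.
rewrite /S; under eq_bigr => a1 _ do under eq_bigr => a2 _ do
  under eq_bigr => a3 _ do under eq_bigr => a4 _ do rewrite gR.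
have factorE (h1 h2 h3 h4 r s t u e : R) :
    (h1 * h2 - h3 * h4) / e * r * s * t * u =
    e^-1 * (h1 * h2 * r * s * t * u - h3 * h4 * r * s * u * t) by ring.
pose H a b := coord_hessian g f a b z.
(* In the second sum a4 is summed before a3: both sums then have the form that
   sum4_factor splits. *)
transitivity ((1 - c)^-1 *
  (\sum_(a1 < m.+1) \sum_(a2 < m.+1) \sum_(a3 < m.+1) \sum_(a4 < m.+1)
     H a1 a3 * H a2 a4 * jac F x p a1 * jac F x i a2 * jac F x j a3 * jac F x k a4
   - \sum_(a1 < m.+1) \sum_(a2 < m.+1) \sum_(a4 < m.+1) \sum_(a3 < m.+1)
     H a1 a4 * H a2 a3 * jac F x p a1 * jac F x i a2 * jac F x k a4 * jac F x j a3)).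
  rewrite -sumrB mulr_sumr; apply: eq_bigr => a1 _.
  rewrite -sumrB mulr_sumr; apply: eq_bigr => a2 _.
  rewrite [X in _ = _ * (_ - X)]exchange_big /= -sumrB mulr_sumr; apply: eq_bigr => a3 _.
  rewrite -sumrB mulr_sumr; apply: eq_bigr => a4 _.
  exact: factorE.
by rewrite !sum4_factor mulrC.
Qed.

(** * From manifolds to charts *)

Lemma posdef_unitmx (R : realType) (n : nat) (G : 'M[R]_n) :
  (forall v : 'rV[R]_n, v != 0 ->
     0 < \sum_(i < n) \sum_(j < n) G i j * v ord0 i * v ord0 j) ->
  G \in unitmx.
Proof.
move=> Gpos; rewrite -row_free_unit -kermx_eq0; apply/rowV0P => v /sub_kermxP vG.
apply/eqP/negPn/negP => /Gpos.
by rewrite -dotE /dot vG mul0mx mxE ltxx.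
Qed.

(** The inverse of a positive definite form is positive definite on covectors,
    so that the gradient is nonzero where the differential is. *)
Lemma posdef_dot_invmx (R : realType) (n : nat) (G : 'M[R]_n) (w : 'rV[R]_n) :
  G^T = G ->
  (forall v : 'rV[R]_n, v != 0 ->
     0 < \sum_(i < n) \sum_(j < n) G i j * v ord0 i * v ord0 j) ->
  w != 0 -> 0 < dot (invmx G) w w.
Proof.
move=> GT Gpos w0; have GU := posdef_unitmx Gpos.
have -> : dot (invmx G) w w = dot G (w *m invmx G) (w *m invmx G).
  by rewrite /dot trmx_mul trmx_inv GT mulmxKV // mulmxA.
rewrite dotE; apply: Gpos; apply: contraNneq w0 => wG.
by rewrite -(mulmxKV GU w) wG mul0mx.
Qed.

Lemma chart_image_open (R : realType) (M : topologicalType) (n : nat)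
    (c : chart R M n) (W : set M) :
  open W -> open (c @` (chart_dom c `&` W)).
Proof.
move=> Wo; rewrite openE => _ [p [cp Wp] <-].
have icp : c p \in c @` chart_dom c by rewrite inE; exists p.
have : nbhs (c p) (chart_inv c @^-1` W).
  apply: (chart_inv_continuous icp); rewrite chart_mapK ?inE //.
  exact: open_nbhs_nbhs.
have : nbhs (c p) (c @` chart_dom c).
  by apply: open_nbhs_nbhs; split; [exact: chart_img_open | exists p].
apply: filterS2 => _ [p' cp' <-] /=; rewrite chart_mapK ?inE // => Wp'.
by exists p'.
Qed.

Lemma smooth_on_sub (R : realType) (n : nat) (U V : set 'rV[R]_n)
    (f : 'rV[R]_n -> R) : U `<=` V -> smooth_on V f -> smooth_on U f.
Proof. by move=> UV fs s x /UV; exact: fs. Qed.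

(** The set [W] allows for a chart of [N] to be cut down to the points that the
    immersion sends into the domain of a given chart of [M]. *)
Lemma metric_on_chart (R : realType) (n : nat) (M : manifold R n)
    (g : metric M) (c : chart R M n) (W : set M) :
  atlas c -> open W ->
  metric_on (c @` (chart_dom c `&` W)) (metric_mx g c).
Proof.
move=> ac Wo; split.
- exact: chart_image_open.
- move=> i j; apply: smooth_on_sub (metric_smooth g ac i j).
  by move=> _ [p [cp _] <-]; exists p.
- by move=> _ [p [cp _] <-] i j; exact: (Defs.metric_sym g (conj ac cp)).
- by move=> _ [p [cp _] <-]; apply: posdef_unitmx; exact: (Defs.metric_pos g (conj ac cp)).
Qed.

Theorem mainTheorem9 (R : realType) (n : nat)
    (M : manifold R n) (gM : metric M) (h : M -> R)
    (h_smooth : smooth_field h)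
    (h_grad : forall (p : M) (c : chart R M n), chart_at c p ->
       grad_sq gM h c p < 1)
    (h_curv : forall (x : M) (c : chart R M n), chart_at c x ->
       forall p i j k : 'I_n,
         curvature gM c x p i j k =
         (hessian gM h c x p j * hessian gM h c x i k
          - hessian gM h c x p k * hessian gM h c x i j)
         / (1 - grad_sq gM h c x))
    (N : manifold R n.-1) (iota : N -> M)
    (iota_inj : injective iota) (iota_imm : immersion iota)
    (h_const : forall q q' : N, h (iota q) = h (iota q'))
    (h_reg : forall (q : N) (d : chart R M n), chart_at d (iota q) ->
       exists a : 'I_n, dfield h d (iota q) a <> 0)
    (gN : metric N) (gN_induced : is_pullback iota gN gM) :
  forall (q : N) (c : chart R N n.-1) (d : chart R M n),
    chart_at c q -> chart_at d (iota q) ->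
    let P := differential iota c d q in
    forall i j k l : 'I_n.-1,
      curvature gN c q i j k l =
      (grad_sq gM h d (iota q))^-1 *
      \sum_(a1 < n) \sum_(a2 < n) \sum_(a3 < n) \sum_(a4 < n)
        curvature gM d (iota q) a1 a2 a3 a4 *
        P i a1 * P j a2 * P k a3 * P l a4.
Proof.
case: n M gM h h_smooth h_grad h_curv N iota iota_inj iota_imm h_const h_reg gN
  gN_induced => [|m] M gM h h_smooth h_grad h_curv N iota _ [[iota_cont iota_smooth] _]
  h_const h_reg gN gN_induced q c d [ac cq] [ad dq] P i j k l.
  by case: i.
pose F := d \o iota \o chart_inv c.
pose U := c @` (chart_dom c `&` iota @^-1` chart_dom d).
(* Written with setT so that metric_on_chart applies to both charts. *)
pose V := d @` (chart_dom d `&` setT).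
have FE p : chart_dom c p -> F (c p) = d (iota p).
  by move=> cp; rewrite /F /= chart_mapK ?inE.
have Wo : open (iota @^-1` chart_dom d).
  by apply: open_comp; [move=> p _; exact: iota_cont | exact: chart_dom_open].
have gMV : metric_on V (metric_mx gM d) by apply: metric_on_chart => //; exact: openT.
have gNU : metric_on U (metric_mx gN c) by exact: metric_on_chart.
have FUV : smooth_between U V F.
  split; first exact: chart_image_open.
    exact: iota_smooth.
  by move=> _ [p [cp dp] <-]; rewrite FE //; exists (iota p).
have pullE y : U y -> metric_mx gN c y = pullback_metric (metric_mx gM d) F y.
  move=> [p [cp dp] <-]; apply/matrixP => i' j'.
  rewrite pullback_metricE dotE FE // (gN_induced p c d) //.
  by apply: eq_bigr => a _; apply: eq_bigr => b _; rewrite !mxE.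
have hs : smooth_on V (h \o chart_inv d).
  by rewrite /V setIT; exact: h_smooth.
have hF y : U y -> (h \o chart_inv d) (F y) = h (iota q).
  move=> [p [cp dp] <-]; rewrite FE //= chart_mapK ?inE //; exact: h_const.
have Ux : U (c q) by exists q.
have Fq : F (c q) = d (iota q) by exact: FE.
have gradE : dot (invmx (metric_mx gM d (F (c q))))
    (gradient_row (h \o chart_inv d) (F (c q)))
    (gradient_row (h \o chart_inv d) (F (c q))) = grad_sq gM h d (iota q).
  rewrite Fq dotE; apply: eq_bigr => a _; apply: eq_bigr => b _.
  by rewrite !mxE.
have grad0 : grad_sq gM h d (iota q) != 0.
  rewrite -gradE Fq gt_eqF //; apply: posdef_dot_invmx.
  - by apply/matrixP => a b; rewrite mxE (Defs.metric_sym gM (conj ad dq)).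
  - exact: (Defs.metric_pos gM (conj ad dq)).
  - have [a da] := h_reg q d (conj ad dq); apply: contra_not_neq da => /rowP/(_ a).
    by rewrite !mxE.
have grad1 : 1 - grad_sq gM h d (iota q) != 0.
  by rewrite gt_eqF // subr_gt0; exact: h_grad.
have := level_set_curvature gMV gNU FUV pullE hs hF Ux.
rewrite /= gradE Fq => /(_ grad0 grad1) curvE.
by apply: curvE => p1 p2 p3 p4; exact: (h_curv (iota q) d (conj ad dq)).
Qed.
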